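(* Let $M$ be a path-circular matroid and let $e\in E(M)$. Then $M\backslash e$ and $M/e$ are both path-circular matroids.
   Context: Let $G$ be a simple graph. A path of $G$ is written as the ordered list of its (distinct) vertices $u_1,\ldots,u_k$, consecutive ones adjacent; paths with zero vertices (''null paths'') and one vertex are allowed. A path-circular collection $\mathcal P$ of $G$ is a collection of (not necessarily distinct) paths of $G$ such that whenever $u_1,\ldots,u_k$ are the vertices in order of a path in $\mathcal P$ and $i\in\{2,\ldots,k-1\}$: (i) $u_i$ has degree $2$ in $G$, and (ii) every path of $\mathcal P$ containing $u_i$ also contains at least one of $u_1,u_k$. If $V(G)=\{v_1,\ldots,v_r\}$, let $N(v_i)=\{p\in\mathcal P: v_i \text{ is a vertex of } p\}$ and let $M(\mathcal P)$ be the transversal matroid on ground set $\mathcal P$ (members of the collection being distinct elements) with presentation $(N(v_1),\ldots,N(v_r))$, i.e. whose independent sets are the sets $\{x_1,\ldots,x_m\}$ of distinct elements for which there are distinct $k_1,\ldots,k_m\in[r]$ with $x_i\in N(v_{k_i})$. A matroid of the form $M(\mathcal P)$ (up to isomorphism) is a path-circular matroid. *)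

(* Defs.v *)
From mathcomp Require Import all_boot.
Set Implicit Arguments. Unset Strict Implicit.
 Unset Printing Implicit Defensive.

Definition simple_graph (V : finType) (adj : rel V) : Prop :=
  symmetric adj /\ irreflexive adj.

Definition deg (V : finType) (adj : rel V) (v : V) : nat := #|[set w | adj v w]|.

Definition gpath (V : finType) (adj : rel V) (p : seq V) : bool :=
  uniq p && (if p is x :: s then path adj x s else true).

(* A path-circular collection, indexed by a finite type I (members of the
   collection are distinct elements even when equal as paths). Internal
   vertices u_i (index 0 < j < k-1, 0-based) have degree 2, and every path of
   the collection containing u_i contains u_1 = head or u_k = last. *)
Definition path_circular (V : finType) (adj : rel V) (I : finType)
    (P : I -> seq V) : Prop :=
  (forall i, gpath adj (P i)) /\
  (forall (i : I) (j : nat) (u : V),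
      0 < j < (size (P i)).-1 -> nth u (P i) j = u ->
      deg adj u = 2 /\
      (forall i' : I, u \in P i' ->
         (head u (P i) \in P i') || (last u (P i) \in P i'))).

(* Independence in the transversal matroid with presentation (N(v))_v,
   N(v) = {p | v in p}: X is independent iff there is an injective
   assignment of vertices to the members of X with x in N(f x). *)
Definition tindep (V : finType) (I : finType) (P : I -> seq V) (X : {set I}) : Prop :=
  exists f : I -> option V,
    (forall x, x \in X -> exists v, f x = Some v /\ v \in P x) /\
    {in X &, injective f}.

Definition path_circular_matroid (E : finType) (indep : {set E} -> Prop) : Prop :=
  exists (V : finType) (adj : rel V) (I : finType) (P : I -> seq V) (phi : E -> I),
    simple_graph adj /\ path_circular adj P /\ bijective phi /\
    (forall X : {set E}, indep X <-> tindep P (phi @: X)).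

Definition del_indep (E : finType) (indep : {set E} -> Prop) (e : E)
    (X : {set {x : E | x != e}}) : Prop :=
  indep [set val x | x in X].

Definition con_indep (E : finType) (indep : {set E} -> Prop) (e : E)
    (X : {set {x : E | x != e}}) : Prop :=
  (indep [set e] -> indep (e |: [set val x | x in X])) /\
  (~ indep [set e] -> indep [set val x | x in X]).
Arguments del_indep {E} indep e X.
Arguments con_indep {E} indep e X.

(* Main.v *)
From Corelib Require Import Setoid.
Require Import Defs.
From mathcomp Require Import all_boot.

Set Implicit Arguments. Unset Strict Implicit. Unset Printing Implicit Defensive.

(**
Only the edges joining consecutive vertices of paths of the collection matter,
and then path-circularity becomes intrinsic to the paths: the neighbours, in
any path, of an internal vertex of a path [p] are its two neighbours in [p],
and a path containing a vertex of [p] contains everything between that vertex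
and one of the two ends of [p].

Deletion is clear.  To contract [e = u_1, ..., u_k], replace [u_1, ..., u_k] by
[w_1, ..., w_(k-1)], where [w_i] (called [u_i] again) belongs to the paths that
contained [u_i] or [u_(i+1)].  Concretely, a path meeting [e] in
[u_j, ..., u_k] with [j > 1] and avoiding [u_(j-1)] has [u_j] as an end, is
prolonged there by [u_(j-1)], and finally [u_k] is removed from all paths.  A
matching of [X] and [e] in which [e] uses [u_m] becomes a matching of [X] by
sending [u_i] to [w_i] for [i < m] and to [w_(i-1)] for [i > m].  Conversely, an
element matched to [w_i] contains all of [u_1, ..., u_i] or all of
[u_(i+1), ..., u_k]; moving the elements of the first kind to the left and the
others to the right yields a matching that leaves one [u_m] free for [e].
*)

(** * Path-circularity read off from the paths alone *)

Definition nb (T : eqType) (s : seq T) (a b : T) : bool :=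
  infix [:: a; b] s || infix [:: b; a] s.

Definition tri (T : eqType) (s : seq T) (a u b : T) : bool :=
  infix [:: a; u; b] s || infix [:: b; u; a] s.

Definition degree2 (T : eqType) (s t : seq T) : Prop :=
  forall a u b c, tri s a u b -> nb t u c -> c = a \/ c = b.

(** For [u] inside [s] this strengthens the condition on the ends of a path from one end to a whole
    stretch, as the shifting of matchings requires. For an end of [s] it is vacuous, one stretch
    being [u] alone. *)
Definition end_closed (T : eqType) (s t : seq T) : Prop :=
  forall s1 u s2, s = s1 ++ u :: s2 -> u \in t ->
  {subset rcons s1 u <= t} \/ {subset u :: s2 <= t}.

Definition thread_family (V : eqType) (I : Type) (P : I -> seq V) : Prop :=
  [/\ forall i, uniq (P i),
      forall i j, degree2 (P i) (P j)
    & forall i j, end_closed (P i) (P j)].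

(** * Consecutive vertices in duplicate-free sequences *)

Lemma uniq_split_inj (T : eqType) (s1 s2 t1 t2 : seq T) (u : T) :
  uniq (s1 ++ u :: s2) -> s1 ++ u :: s2 = t1 ++ u :: t2 -> s1 = t1 /\ s2 = t2.
Proof.
move=> Us E; have Ut : uniq (t1 ++ u :: t2) by rewrite -E.
have sz (r1 r2 : seq T) : uniq (r1 ++ u :: r2) -> index u (r1 ++ u :: r2) = size r1.
  rewrite cat_uniq /= negb_or index_cat => /and3P [_ /andP [/negbTE -> _] _].
  by rewrite /= eqxx addn0.
have := sz _ _ Us; rewrite E (sz _ _ Ut) => S12.
by move/eqP: E; rewrite eqseq_cat // => /andP [/eqP -> /eqP [->]].
Qed.

Lemma mem_cat_split (T : eqType) (z : T) (s : seq T) :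
  z \in s -> exists s1 s2, s = s1 ++ z :: s2.
Proof. by case/splitPr=> s1 s2; exists s1, s2. Qed.

Lemma subset_or_split (T : eqType) (r t : seq T) :
  {subset r <= t} \/
  exists q b p, [/\ r = q ++ b :: p, {subset q <= t} & b \notin t].
Proof.
case: (boolP (all (mem t) r)) => [/allP|]; first by left.
rewrite -has_predC => h; right; have [b q p bt qt] := split_find h.
exists q, b, p; rewrite cat_rcons; split=> // z zq; apply/negPn/negP => zt.
by case/hasP: qt; exists z.
Qed.

Lemma infix_mem2 (T : eqType) (a b : T) (s : seq T) :
  infix [:: a; b] s -> a \in s /\ b \in s.
Proof. by move=> /mem_infix H; split; apply: H; rewrite !inE eqxx ?orbT. Qed.

Lemma infix_neq2 (T : eqType) (a b : T) (s : seq T) :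
  uniq s -> infix [:: a; b] s -> a != b.
Proof. by move=> Us /infix_uniq /(_ Us) /=; rewrite inE andbT. Qed.

Lemma nbC (T : eqType) (s : seq T) a b : nb s a b = nb s b a.
Proof. by rewrite /nb orbC. Qed.

Lemma triC (T : eqType) (s : seq T) a u b : tri s a u b = tri s b u a.
Proof. by rewrite /tri orbC. Qed.

Lemma nb_rev (T : eqType) (s : seq T) a b : nb (rev s) a b = nb s a b.
Proof.
by rewrite /nb -(infix_rev [:: a; b]) -(infix_rev [:: b; a]) revK orbC.
Qed.

Lemma tri_rev (T : eqType) (s : seq T) a u b : tri (rev s) a u b = tri s a u b.
Proof.
by rewrite /tri -(infix_rev [:: a; u; b]) -(infix_rev [:: b; u; a]) revK orbC.
Qed.

Lemma end_closed_rev (T : eqType) (s t : seq T) : end_closed s t -> end_closed (rev s) t.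
Proof.
move=> H s1 u s2 E ut.
have {}E : s = rev s2 ++ u :: rev s1.
  by rewrite -[s]revK E rev_cat rev_cons cat_rcons.
have sub (r : seq T) : {subset r <= t} -> {subset rev r <= t}.
  by move=> h z; rewrite mem_rev; apply: h.
case: (H _ _ _ E ut) => h; [right | left]; move/sub: h.
  by rewrite rev_rcons revK.
by rewrite rev_cons revK.
Qed.

Lemma nb_mem (T : eqType) (s : seq T) a b : nb s a b -> a \in s /\ b \in s.
Proof. by case/orP => /infix_mem2 []. Qed.

Lemma nb_neq (T : eqType) (s : seq T) a b : uniq s -> nb s a b -> a != b.
Proof. by move=> Us /orP [] /(infix_neq2 Us) //; rewrite eq_sym. Qed.

Lemma tri_nb (T : eqType) (s : seq T) a u b : tri s a u b -> nb s u a /\ nb s u b.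
Proof.
case/orP => /infixP [p [q ->]].
  split; apply/orP; [right | left]; apply/infixP.
    by exists p, (b :: q).
  by exists (rcons p a), q; rewrite cat_rcons.
split; apply/orP; [left | right]; apply/infixP.
  by exists (rcons p b), q; rewrite cat_rcons.
by exists p, (a :: q).
Qed.

Lemma tri_neq (T : eqType) (s : seq T) a u b : uniq s -> tri s a u b -> a != b.
Proof.
move=> Us /orP [] /infix_uniq /(_ Us) /=; rewrite !inE negb_or => /andP [/andP [_]] //.
by rewrite eq_sym.
Qed.

Lemma tri_head (T : eqType) (s : seq T) a u b : uniq s -> tri s a u b -> head u s != u.
Proof.
move=> Us /orP [] /infixP [p [q E]]; move: Us; rewrite E;
  case: p {E} => [|x p] /=; rewrite ?mem_cat !inE !negb_or -?andbA.
- by case/andP.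
- by case/and4P.
- by case/andP.
- by case/and4P.
Qed.

Lemma infix2_inj (T : eqType) (s : seq T) a b u :
  uniq s -> infix [:: a; u] s -> infix [:: b; u] s -> a = b.
Proof.
move=> Us /infixP [p [q E]] /infixP [p' [q' E']].
have {}E : s = rcons p a ++ u :: q by rewrite E cat_rcons.
have {}E' : s = rcons p' b ++ u :: q' by rewrite E' cat_rcons.
move: Us; rewrite E => /uniq_split_inj /(_ (etrans (esym E) E')) [] /eqP.
by rewrite eqseq_rcons => /andP [_ /eqP].
Qed.

Lemma infix_glue (T : eqType) (s : seq T) a u b :
  uniq s -> infix [:: a; u] s -> infix [:: u; b] s -> infix [:: a; u; b] s.
Proof.
move=> Us /infixP [p [q E]] /infixP [p' [q' E']].
have {}E : s = rcons p a ++ u :: q by rewrite E cat_rcons.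
move: Us; rewrite E => /uniq_split_inj /(_ (etrans (esym E) E')) [_ ->].
by apply/infixP; exists p, q'; rewrite cat_rcons.
Qed.

(** * Removing vertices from a sequence, and connectedness *)

Lemma infix2_filter (T : eqType) (v a b : T) (s : seq T) :
  uniq s -> infix [:: a; b] (filter (predC1 v) s) ->
  infix [:: a; b] s \/ infix [:: a; v; b] s.
Proof.
move=> Us; have a0 (r : seq T) : v \notin r -> filter (predC1 v) r = r.
  move=> vr; apply/all_filterP/allP => z zr /=.
  by apply: contra vr => /eqP <-.
case: (boolP (v \in s)) => vs; last by rewrite a0 //; left.
case/splitPr: vs Us => p q; rewrite cat_uniq /= negb_or.
move=> /and3P [Up /andP [vp _] /andP [vq Uq]].
rewrite filter_cat /= eqxx /= !a0 // => {a0 Up Uq vp vq}.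
elim: p => [|x p IH] /=; first by move=> h; left; rewrite h orbT.
case/orP => [/andP [/eqP <-]|/IH [] ->]; [|by left; rewrite orbT|by right; rewrite orbT].
case: p {IH} => [|y p] /=.
  by rewrite eqxx; case: q => [|z q] //= /andP [/eqP -> _]; right; rewrite !eqxx prefix0s.
by move=> /andP [/eqP -> _]; left; rewrite !eqxx prefix0s.
Qed.

Lemma nb_filter (T : eqType) (v a b : T) (s : seq T) :
  uniq s -> nb (filter (predC1 v) s) a b -> nb s a b \/ tri s a v b.
Proof.
move=> Us /orP [] /(infix2_filter Us) [h|h]; rewrite /nb /tri h ?orbT; by [left|right].
Qed.

Lemma tri_filter (T : eqType) (v a' u b' : T) (s : seq T) :
  uniq s -> tri (filter (predC1 v) s) a' u b' ->
  exists a b, [/\ tri s a u b, a = a' \/ a = v /\ tri s a' v u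
                             & b = b' \/ b = v /\ tri s b' v u].
Proof.
move=> Us; wlog: a' b' / infix [:: a'; u; b'] (filter (predC1 v) s).
  move=> H /orP [h|h]; first by apply: H => //; rewrite /tri h.
  have [|a [b [h1 h2 h3]]] := H _ _ h; first by rewrite /tri h.
  by exists b, a; rewrite triC.
move=> h _; have [h1 h2] : infix [:: a'; u] (filter (predC1 v) s) /\
    infix [:: u; b'] (filter (predC1 v) s).
  case/infixP: h => p [q ->]; split; apply/infixP; first by exists p, (b' :: q).
  by exists (rcons p a'), q; rewrite cat_rcons.
have [a [ia ha]] : exists a, infix [:: a; u] s /\ (a = a' \/ a = v /\ tri s a' v u).
  case: (infix2_filter Us h1) => [|k]; first by exists a'; split; [|left].
  exists v; split; last by right; split=> //; rewrite /tri k.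
  by case/infixP: k => p [q ->]; apply/infixP; exists (rcons p a'), q; rewrite cat_rcons.
have [b [ib hb]] : exists b, infix [:: u; b] s /\ (b = b' \/ b = v /\ tri s b' v u).
  case: (infix2_filter Us h2) => [|k]; first by exists b'; split; [|left].
  exists v; split; last by right; split=> //; rewrite /tri k orbT.
  by case/infixP: k => p [q ->]; apply/infixP; exists p, (b' :: q).
by exists a, b; split=> //; rewrite /tri (infix_glue Us ia ib).
Qed.

Lemma end_closed_filter (T : eqType) (p : pred T) (s t : seq T) :
  end_closed s t -> end_closed (filter p s) (filter p t).
Proof.
have sub (r : seq T) : {subset r <= t} -> {subset filter p r <= filter p t}.
  by move=> h z; rewrite !mem_filter => /andP [-> /h].
move=> H s1 u s2 E; rewrite mem_filter => /andP [pu ut].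
(* The splitting at [u] of the filtered sequence lifts to a splitting of [s] at the same vertex. *)
have [r1 [r2 [{}E <- <-]]] :
    exists r1 r2, [/\ s = r1 ++ u :: r2, filter p r1 = s1 & filter p r2 = s2].
  elim: s s1 E {H} => [|x s IH] [|y s1] //=; case: ifP => px //.
  - by case=> -> <-; exists [::], s.
  - by move=> /(IH [::]) [r1 [r2 [-> h <-]]]; exists (x :: r1), r2; rewrite /= px.
  - by case=> <- /IH [r1 [r2 [-> <- <-]]]; exists (x :: r1), r2; rewrite /= px.
  - by move=> /(IH (y :: s1)) [r1 [r2 [-> h <-]]]; exists (x :: r1), r2; rewrite /= px.
case: (H _ _ _ E ut) => /sub h; [left | right]; move: h.
  by rewrite filter_rcons pu.
by rewrite /= pu.
Qed.

(** This is the connectedness of a path: a property passed on to neighbours spreads from one vertex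
    to all. *)
Lemma nb_closed_all (T : eqType) (A : pred T) (s : seq T) z :
  (forall a b, nb s a b -> A a -> A b) -> z \in s -> A z -> all A s.
Proof.
elim: s z => [//|x s IH] z H zs Az /=.
have {}IH y : y \in s -> A y -> all A s.
  by apply: IH => a b /orP ab; apply: H; rewrite /nb /=; case: ab => ->; rewrite ?orbT.
case: s H IH zs => [|y s] H IH; first by rewrite inE => /eqP <-; rewrite Az.
have xy : nb (x :: y :: s) x y by rewrite /nb /= !eqxx prefix0s.
rewrite inE => /predU1P [Ez|/IH /(_ Az) As].
  rewrite -Ez Az /=; apply: (IH y); rewrite ?mem_head //.
  by apply: H xy _; rewrite -Ez.
rewrite As andbT; apply: (H y); first by rewrite nbC.
by case/andP: As.
Qed.

(** * Path-circular collections and thread families are the same *)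

Lemma gpath_infix (V : finType) (adj : rel V) (s : seq V) a b :
  gpath adj s -> infix [:: a; b] s -> adj a b.
Proof.
move=> /andP [_ Ps] /infixP [p [q E]]; move: Ps; rewrite {}E.
by case: p => [|x p] /=; rewrite ?cat_path /=; [case/andP | case/and4P].
Qed.

Lemma gpath_nb (V : finType) (adj : rel V) (s : seq V) a b :
  symmetric adj -> gpath adj s -> nb s a b -> adj a b.
Proof. by move=> sadj Ps /orP [] /(gpath_infix Ps) //; rewrite sadj. Qed.

Lemma path_circular_internal (V : finType) (adj : rel V) (I : finType)
    (P : I -> seq V) i a u b :
  path_circular adj P -> tri (P i) a u b ->
  deg adj u = 2 /\ forall j, u \in P j ->
    (head u (P i) \in P j) || (last u (P i) \in P j).
Proof.
by move=> [_ Pint] /orP [] /infixP [p [q E]];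
  apply: (Pint i (size p).+1); rewrite E ?nth_cat ?ltnNge ?leqnSn /=
    ?subSnn // size_cat /= !addnS /= -leqNgt ltnS leq_addr.
Qed.

(* Among the stretches of [s] around an element of [t] that lie in [t], take a
   maximal one: if it reached no end of [s], its elements would have no
   neighbours in [t] outside it, so [t] would be contained in it. *)
Lemma end_closed_of_degree (T : eqType) (s t : seq T) :
  uniq s ->
  degree2 s t ->
  (forall a u b, tri s a u b -> u \in t -> (head u s \in t) || (last u s \in t)) ->
  end_closed s t.
Proof.
move=> Us D ends s1 u s2 E ut.
case: (subset_or_split (rev s1) t) => [h|[q1 [a [p1 [/(congr1 rev)]]]]].
  left=> z; rewrite mem_rcons inE => /predU1P [-> //|zs].
  by apply: h; rewrite mem_rev.
rewrite revK rev_cat rev_cons cat_rcons => E1 q1t at'.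
case: (subset_or_split s2 t) => [h|[q2 [b [p2 [E2 q2t bt]]]]].
  by right=> z; rewrite inE => /predU1P [-> //|]; apply: h.
(* [g] is the maximal stretch around [u] inside [t]; in [s] it is bounded by [a] and [b], both
   outside [t]. *)
pose g := rev q1 ++ u :: q2.
have Es : s = (rev p1 ++ a :: g) ++ b :: p2.
  by rewrite E E1 E2 /g -!catA /= -!catA.
have gt : {subset g <= t}.
  move=> z; rewrite mem_cat mem_rev inE.
  by case/or3P => [/q1t|/eqP ->|/q2t].
have tris z : z \in g -> exists c d, [/\ tri s c z d, c \in a :: g & d \in rcons g b].
  move=> /mem_cat_split [m1 [m2 Eg]]; rewrite Eg in Es *.
  exists (last a m1), (head b m2); split.
  - apply/orP; left; apply/infixP.
    exists (rev p1 ++ belast a m1), (behead (rcons m2 b) ++ p2).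
    rewrite Es -!catA /= -!catA; congr cat.
    by rewrite -cat_cons lastI cat_rcons; case: (m2) => [|y m] //=; rewrite cat_rcons.
  - by rewrite -cat_cons mem_cat mem_last.
  - by case: m2 {Es Eg} => [|y m2] /=; rewrite mem_rcons !inE mem_cat !inE eqxx ?orbT.
have ug : u \in g by rewrite mem_cat mem_head orbT.
have tg : all (mem g) t.
  apply: (nb_closed_all _ ut ug) => c d cd cg.
  have [a' [b' [t' a'g b'g]]] := tris _ cg.
  have [_ dt] := nb_mem cd.
  case: (D _ _ _ _ t' cd) => Ed.
    by move: a'g; rewrite -Ed inE => /predU1P [Ea|//]; rewrite -Ea dt in at'.
  by move: b'g; rewrite -Ed mem_rcons inE => /predU1P [Ea|//]; rewrite -Ea dt in bt.
(* Since [t] is contained in [g], an end of [s] lying in [t] would lie in [g]; but the head of [s]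
   comes before [g] and its last vertex after it. *)
have [a' [b' [t' _ _]]] := tris _ ug.
exfalso; have := ends _ _ _ t' ut.
have hs : head u s \in rcons (rev p1) a.
  by rewrite Es; case: (rev p1) => [|x p] /=; rewrite ?mem_rcons ?inE ?eqxx ?orbT.
have ls : last u s \in b :: p2 by rewrite Es last_cat /= mem_last.
have Eg : s = rcons (rev p1) a ++ g ++ b :: p2 by rewrite cat_rcons Es -catA.
move: Us; rewrite {1}Eg !cat_uniq => /and3P [_ d1 /and3P [_ d2 _]].
case/orP => /(allP tg) /= hg.
  by case/hasP: d1; exists (head u s); rewrite // mem_cat hg.
by case/hasP: d2; exists (last u s).
Qed.

(** The two neighbours of an internal vertex in its path are distinct, so they exhaust its degree 2
    in the graph. *)
Lemma path_circular_threads (V : finType) (adj : rel V) (I : finType)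
    (P : I -> seq V) :
  simple_graph adj -> path_circular adj P -> thread_family P.
Proof.
move=> [sadj _] PC; have [gP _] := PC.
have U i : uniq (P i) by case/andP: (gP i).
have D i j : degree2 (P i) (P j).
  move=> a u b c t uc; have [dg _] := path_circular_internal PC t.
  have [ua ub] := tri_nb t.
  have ab := tri_neq (U i) t.
  have sub : [set a; b] \subset [set w | adj u w].
    by rewrite subUset !sub1set !inE !(gpath_nb sadj (gP i)).
  have /eqP eqs : [set a; b] == [set w | adj u w].
    by rewrite eqEcard sub cards2 ab /= -dg.
  have : c \in [set a; b] by rewrite eqs inE (gpath_nb sadj (gP j)).
  by rewrite !inE => /orP [] /eqP ->; [left | right].
split=> // i j; apply: end_closed_of_degree => // a u b t uj.
by have [_ h] := path_circular_internal PC t; apply: h.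
Qed.

Lemma threads_path_circular (V : finType) (I : finType) (P : I -> seq V) :
  thread_family P ->
  exists2 adj : rel V, simple_graph adj & path_circular adj P.
Proof.
move=> [U D S]; pose adj : rel V := fun u w => [exists i, nb (P i) u w].
exists adj.
  split=> [u w|u]; first by apply: eq_existsb => i; rewrite nbC.
  by apply/existsP => [[i /(nb_neq (U i))]]; rewrite eqxx.
split=> [i|i j u /andP [j0 jn] nj].
  rewrite /gpath U /=; case E: (P i) => [//|x s].
  have: forall a b, infix [:: a; b] (x :: s) -> adj a b.
    by move=> a b ab; apply/existsP; exists i; rewrite E /nb ab.
  elim: s x {E} => [//|y s IH] x H /=; apply/andP; split.
    by apply: H => /=; rewrite !eqxx prefix0s.
  by apply: IH => a b ab; apply: H; apply: infix_trans ab (infix_cons _ _).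
(* From here on [u] is at position [j.+1], between [a] at [j] and [b] at [j.+2]. *)
case: j j0 jn nj => // j _ jn nj.
have jn1 : j.+1 < size (P i) by case: (size _) jn => //= n; apply: ltnW.
have jn2 : j.+2 < size (P i) by case: (size _) jn.
have E : P i = take j (P i) ++ nth u (P i) j :: u :: nth u (P i) j.+2 :: drop j.+3 (P i).
  rewrite -{1}(cat_take_drop j (P i)) (drop_nth u (ltnW jn1)).
  by rewrite (drop_nth u jn1) (drop_nth u jn2) nj.
set a := nth u (P i) j in E; set b := nth u (P i) j.+2 in E.
have t : tri (P i) a u b.
  by apply/orP; left; apply/infixP; exists (take j (P i)), (drop j.+3 (P i)).
have [ua ub] := tri_nb t.
split=> [|k uk].
  have ab : a != b by rewrite nth_uniq ?(ltnW jn1) // neq_ltn leqnSn.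
  have -> : deg adj u = #|[set a; b]|; last by rewrite cards2 ab.
  congr #|pred_of_set _|; apply/setP => c; rewrite !inE.
  apply/existsP/orP => [[k /(D _ _ _ _ _ _ t) [] ->]|[] /eqP ->]; rewrite ?eqxx.
  - by left.
  - by right.
  - by exists i.
  - by exists i.
have E' : P i = rcons (take j (P i)) a ++ u :: b :: drop j.+3 (P i) by rewrite cat_rcons.
apply/orP; case: (S _ _ _ _ _ E' uk) => h; [left | right]; apply: h.
  rewrite {1}E; case: (take j (P i)) => [|x s] /=; last by rewrite mem_head.
  by rewrite mem_head.
by rewrite {1}E' last_cat /= inE mem_last orbT.
Qed.

(** * Prolonging the paths that meet the contracted path *)

(* In the second case [x] has been oriented so that [d] is its head; in the
   notation of the header, [c = u_(j-1)] and [d = u_j]. *)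
Definition extends (T : eqType) (e x t : seq T) : Prop :=
  (t = x /\ forall c d, infix [:: c; d] e -> d \in x -> c \in x) \/
  exists p c d r s, [/\ e = p ++ [:: c, d & r], c \notin x,
    {subset d :: r <= x}, d :: s = x \/ d :: s = rev x & t = [:: c, d & s]].

(** Let [c] be the last vertex of [e] outside [x]. If [c] ends [e], end-closedness puts into [x] the
    predecessor of any vertex of [e] in [x]. Otherwise its successor [d] is in [x] and must be an
    end of [x]: if it were internal, [degree2] would make [c] one of its neighbours in [x]. *)
Lemma extends_exists (T : eqType) (e x : seq T) :
  end_closed e x -> degree2 x e -> exists t, extends e x t.
Proof.
move=> St D.
have [ex|[q [c [p [/(congr1 rev) E qx cx]]]]] := subset_or_split (rev e) x.
  by exists x; left; split=> // c d /infix_mem2 [ce _] _; apply: ex; rewrite mem_rev.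
have {}qx : {subset rev q <= x} by move=> z; rewrite mem_rev => /qx.
move: E; rewrite revK rev_cat rev_cons cat_rcons => E.
case: (rev q) E qx => [|d r] E rx.
  exists x; left; split=> // c' d' /infixP [p' [q' E']] d'x.
  have {}E' : e = rcons p' c' ++ d' :: q' by rewrite E' cat_rcons.
  case: (St _ _ _ E' d'x) => h.
    by apply: h; rewrite mem_rcons inE mem_rcons mem_head orbT.
  have : last c e \in d' :: q' by rewrite E' last_cat /= mem_last.
  by rewrite E last_cat /= => /h; rewrite (negbTE cx).
have dx : d \in x by apply: rx; rewrite mem_head.
have [x1 [x2 Ex]] := mem_cat_split dx.
have de : nb e d c.
  by apply/orP; right; apply/infixP; exists (rev p), r; rewrite E.
have [s xs] : exists s, d :: s = x \/ d :: s = rev x.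
  case/lastP: x1 Ex => [|x1 a] Ex; first by exists x2; left.
  case: x2 Ex => [|b x2] Ex.
    by exists (rev (rcons x1 a)); right; rewrite Ex rev_cat.
  have t : tri x a d b.
    by apply/orP; left; apply/infixP; exists x1, x2; rewrite Ex cat_rcons.
  have [/nb_mem [_ ax] /nb_mem [_ bx]] := tri_nb t.
  by case: (D _ _ _ _ t de) => Ec; move: cx; rewrite /= Ec ?ax ?bx.
by exists [:: c, d & s]; right; exists (rev p), c, d, r, s; split.
Qed.

Lemma extends_sub (T : eqType) (e x t : seq T) : extends e x t -> {subset x <= t}.
Proof.
case=> [[-> _] //|[p [c [d [r [s [_ _ _ xs ->]]]]]]] z zx.
by rewrite inE; case: xs => ->; rewrite ?mem_rev zx orbT.
Qed.

Lemma extends_uniq (T : eqType) (e x t : seq T) : extends e x t -> uniq x -> uniq t.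
Proof.
case=> [[-> _] //|[p [c [d [r [s [_ cx _ xs ->]]]]]]] Ux.
by rewrite cons_uniq; case: xs => ->; rewrite ?mem_rev ?rev_uniq cx.
Qed.

Lemma extends_pred (T : eqType) (e x t : seq T) c d :
  uniq e -> end_closed e x -> extends e x t -> infix [:: c; d] e -> d \in x -> c \in t.
Proof.
move=> Ue St ext cd dx; have xt := extends_sub ext.
case: ext => [[-> h] | [p [c' [d' [r [s [E c'x rx _ Et]]]]]]]; first exact: h cd dx.
case: (infix_mem2 cd) => ce _.
case/infixP: cd => p1 [q E1].
have E2 : e = rcons p1 c ++ d :: q by rewrite E1 cat_rcons.
case: (St _ _ _ E2 dx) => h.
  by apply/xt/h; rewrite mem_rcons inE mem_rcons mem_head orbT.
move: ce; rewrite {1}E mem_cat inE => /or3P [|/eqP ->|/rx/xt //].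
  (* If [c] came strictly before [c'], then [c'] would belong to the part of [e] from [d] on, which
     lies in [x]. *)
  case/mem_cat_split => pa [pb Ep]; move: (Ue); rewrite E Ep -catA cat_cons => Up.
  have [|_ Eq] := @uniq_split_inj _ _ _ p1 (d :: q) _ Up.
    by rewrite -[RHS]E1 E Ep -catA.
  by case/negP: c'x; apply: h; rewrite -Eq mem_cat mem_head orbT.
by rewrite Et mem_head.
Qed.

(** With [d] the successor of [u = u_i] in [e], this is the membership rule of [w_i]. It covers both
    cases of [extends] and does not depend on the choice of [t]. *)
Lemma mem_extends (T : eqType) (e x t : seq T) u :
  uniq e -> end_closed e x -> extends e x t ->
  u \in t <-> u \in x \/ exists2 d, infix [:: u; d] e & d \in x.
Proof.
move=> Ue St ext; split=> [|[/(extends_sub ext) //|[d]]]; last first.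
  exact: extends_pred.
case: ext => [[-> _]|[p [c [d [r [s [E _ rx xs ->]]]]]]]; first by left.
rewrite inE => /predU1P [->|us]; last by left; case: xs us => ->; rewrite ?mem_rev.
right; exists d; last by apply: rx; rewrite mem_head.
by apply/infixP; exists p, r.
Qed.

Lemma nb_extends (T : eqType) (e x t : seq T) u c :
  extends e x t -> nb t u c -> nb x u c \/ nb e u c.
Proof.
case=> [[-> _]|[p [a [d [r [s [E _ _ xs ->]]]]]]]; first by left.
have xn : nb (d :: s) u c = nb x u c by case: xs => ->; rewrite ?nb_rev.
rewrite -xn; have ed : infix [:: a; d] e by apply/infixP; exists p, r.
rewrite {1}/nb /= => /orP [] /orP [/and3P [/eqP -> /eqP -> _]|h].
- by right; rewrite /nb ed.
- by left; rewrite /nb /= h.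
- by right; rewrite /nb ed orbT.
- by left; rewrite /nb /= h orbT.
Qed.

(** A triple of [t] not in [x] consists of the added [c], then [d], then the neighbour [b] of [d] in
    [x]. If [d] has a successor in [e], [degree2] makes it equal to [b], because [c] is not in [x];
    so the triple is in [e]. Otherwise [d] ends [e], the exceptional third case, where the
    predecessor of [d] in [e] is the head of [t]. *)
Lemma tri_extends (T : eqType) (e x t : seq T) a u b :
  degree2 e x -> extends e x t -> tri t a u b ->
  [\/ tri x a u b, tri e a u b
    | last u e = u /\ (infix [:: a; u] e /\ head u t = a \/
                       infix [:: b; u] e /\ head u t = b)].
Proof.
move=> D; case=> [[-> _]|[p [c [d [r [s [E cx _ xs ->]]]]]]]; first by constructor 1.
wlog: a b / infix [:: a; u; b] [:: c, d & s] => [H /orP [] h|].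
- by apply: H; rewrite // /tri h.
- have := H _ _ h; rewrite /tri h => /(_ isT) [k|k|[k1 k2]].
  + by constructor 1; rewrite orbC.
  + by constructor 2; rewrite orbC.
  by constructor 3; split=> //; case: k2; [right | left].
have ed : infix [:: c; d] e by apply/infixP; exists p, r.
rewrite /= => /orP [/and3P [/eqP -> /eqP -> bs]|h _]; last first.
  constructor 1; have : tri (d :: s) a u b by rewrite /tri /= h.
  by case: xs => ->; rewrite ?tri_rev.
move=> _; case: s xs bs => [//|b' s] xs /= /andP [/eqP bb' _]; rewrite -{b'}bb' in xs.
have db : nb x d b.
  have : nb [:: d, b & s] d b by rewrite /nb /= !eqxx prefix0s.
  by case: xs => ->; rewrite ?nb_rev.
have [_ bx] := nb_mem db.
case: r E => [|r0 r] E.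
  by constructor 3; split; [rewrite E last_cat | left].
have cdr : tri e c d r0 by apply/orP; left; apply/infixP; exists p, r.
constructor 2; case: (D _ _ _ _ cdr db) => [Eb|-> //].
by rewrite -Eb bx in cx.
Qed.

(** At a vertex of [y] the stretches are those of [x]; one reaching the added vertex passes through
    its successor in [e], so [extends_pred] applies. At a vertex [u] added to [y], the successor of
    [u] in [e] is in [y]. If [u] is internal in [tx], this successor is next to it there, and its
    stretch also serves [u]. *)
Lemma end_closed_extends (T : eqType) (e x y tx ty : seq T) :
  uniq e -> degree2 e e -> degree2 e x -> degree2 x e ->
  end_closed e y -> end_closed x y ->
  extends e x tx -> extends e y ty -> end_closed tx ty.
Proof.
move=> Ue Dee Dex Dxe Sey Sxy ex ey s1 u s2 E uty.
have yty := extends_sub ey.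
have end_closed1 r1 w r2 : tx = r1 ++ w :: r2 -> w \in y ->
    {subset rcons r1 w <= ty} \/ {subset w :: r2 <= ty}.
  case: (ex) => [[-> _]|[p [c [d [r [s [Ee _ _ xs ->]]]]]]] Er wy.
    by case: (Sxy _ _ _ Er wy) => h; [left | right] => z /h /yty.
  case: r1 Er => [_|c' r1 [<- Er]].
    by left=> z; rewrite inE => /eqP ->; apply: yty.
  have S0 : end_closed (d :: s) y by case: xs => ->; [|apply: end_closed_rev].
  case: (S0 _ _ _ Er wy) => h; last by right=> z /h /yty.
  left=> z; rewrite inE => /predU1P [->|/h /yty //].
  apply: (@extends_pred _ e y _ c d) => //; first by apply/infixP; exists p, r.
  apply: h; case: r1 Er => [|? r1] [-> _]; first by rewrite mem_head.
  by rewrite mem_head.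
case: (boolP (u \in y)) => [|uy]; first exact: end_closed1.
have [d ud dy] : exists2 d, infix [:: u; d] e & d \in y.
  by case/(mem_extends _ Ue Sey ey): uty => // uy'; rewrite uy' in uy.
have nud : nb e u d by rewrite /nb ud.
have sub1 : {subset [:: u] <= ty} by move=> z; rewrite inE => /eqP ->.
case/lastP: s1 E => [|s1 a] E; first by left.
case: s2 E => [|b s2] E; first by right.
have t : tri tx a u b.
  by apply/orP; left; apply/infixP; exists s1, s2; rewrite E cat_rcons.
have [Ed|Ed] : d = a \/ d = b.
  case: (tri_extends Dex ex t) => [t'|t'|[lu _]].
  - exact: Dxe t' nud.
  - exact: Dee t' nud.
  case/infixP: ud => p [q Ee].
  move: lu Ue; rewrite Ee last_cat cat_uniq /= => <- /and4P [_ _].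
  by rewrite mem_last.
- case: (@end_closed1 s1 d (u :: b :: s2)) => // [|h|h]; first by rewrite E -Ed cat_rcons.
    left=> z; rewrite mem_rcons inE -Ed => /predU1P [-> //|]; exact: h.
  by right=> z zs; apply: h; rewrite inE zs orbT.
case: (@end_closed1 (rcons (rcons s1 a) u) d s2) => // [|h|h].
- by rewrite E -Ed [RHS]cat_rcons.
- by left=> z zs; apply: h; rewrite mem_rcons inE zs orbT.
right=> z; rewrite inE -Ed => /predU1P [-> //|]; exact: h.
Qed.

Lemma thread_family_contract (V : eqType) (I : Type) (P Q : I -> seq V) i0 e' v :
  thread_family P -> P i0 = rcons e' v ->
  (forall i, extends (P i0) (P i) (Q i)) ->
  thread_family (fun i => filter (predC1 v) (Q i)).
Proof.
move=> [U D S] Ee ext.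
have UQ i : uniq (Q i) by apply: extends_uniq (ext i) (U i).
split=> [i|i j|i j]; first by rewrite filter_uniq.
  (* Away from [v], the last vertex of [P i0], the exceptional case of [tri_extends] is impossible,
     so triples and adjacencies come from the old paths. *)
  have hat a u b c : u != v -> tri (Q i) a u b -> nb (Q j) u c -> c = a \/ c = b.
    move=> uv /(tri_extends (D _ _) (ext i)) t /(nb_extends (ext j)) n.
    case: t => [t|t|[]]; last by rewrite Ee last_rcons => uv'; rewrite uv' eqxx in uv.
      by case: n; apply: D t.
    by case: n; apply: D t.
  (* Removing [v] joins its two neighbours. When both triples at [v] are exceptional, the
     predecessor of [v] in [P i0] is [a], because [u] is not the head of [Q i]. In [Q j] it is [u]
     or [c], hence it is [c]. *)
  have skip a u c : head u (Q i) != u -> tri (Q i) a v u -> tri (Q j) u v c -> c = a.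
    move=> hu t1 t2.
    have [_ nc] := tri_nb t2; have [na _] := tri_nb t1.
    have cu : c <> u by apply/eqP; rewrite eq_sym (tri_neq (UQ j) t2).
    have au : a <> u by apply/eqP; rewrite (tri_neq (UQ i) t1).
    case: (tri_extends (D _ _) (ext i) t1) => [t|t|[_ k1]].
    - by case: (nb_extends (ext j) nc) => n; case: (D _ _ _ _ _ _ t n).
    - by case: (nb_extends (ext j) nc) => n; case: (D _ _ _ _ _ _ t n).
    case: (tri_extends (D _ _) (ext j) t2) => [t|t|[_ k2]].
    - by case: (nb_extends (ext i) na) => n; case: (D _ _ _ _ _ _ t n).
    - by case: (nb_extends (ext i) na) => n; case: (D _ _ _ _ _ _ t n).
    have {}k1 : infix [:: a; v] (P i0).
      case: k1 => [[] //|[_ hu']]; case/eqP: hu.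
      by case: (Q i) hu' t1.
    case: k2 => [[k2 _]|[k2 _]]; last exact: (infix2_inj (U i0) k2 k1).
    by case: au; apply: (infix2_inj (U i0) k1 k2).
  move=> a' u b' c t n.
  have [/nb_mem [uf af] /nb_mem [_ bf]] := tri_nb t.
  have [_ cf] := nb_mem n.
  move: uf af bf cf; rewrite !mem_filter /=.
  move=> /andP [uv _] /andP [av _] /andP [bv _] /andP [cv _].
  have [a [b [t' ha hb]]] := tri_filter (UQ i) t.
  have hu := tri_head (UQ i) t'.
  (* Either [u] and [c] were already adjacent in [Q j], or [v] stood between them; then [v] is also
     next to [u] in [Q i], and [skip] applies. *)
  case: (nb_filter (UQ j) n) => [n'|tj].
    case: (hat _ _ _ _ uv t' n') => Ec; [left; case: ha | right; case: hb].
    - by move=> <-.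
    - by move=> [Ea _]; rewrite Ec Ea eqxx in cv.
    - by move=> <-.
    - by move=> [Ea _]; rewrite Ec Ea eqxx in cv.
  have nuv : nb (Q j) u v by rewrite nbC; case: (tri_nb tj).
  case: (hat _ _ _ _ uv t' nuv) => Ev; [left; case: ha | right; case: hb].
  - by move=> Ea; rewrite -Ea Ev eqxx in av.
  - by move=> [_ ta]; apply: (skip _ u).
  - by move=> Ea; rewrite -Ea Ev eqxx in bv.
  - by move=> [_ ta]; apply: (skip _ u).
by apply/end_closed_filter/(end_closed_extends (U i0) _ _ _ _ _ (ext i) (ext j)).
Qed.

(** * Transversal matroids of thread families *)

Lemma tindep_imset (V : finType) (I J : finType) (P : I -> seq V) (phi : J -> I)
    (X : {set J}) :
  injective phi -> tindep P (phi @: X) <-> tindep (P \o phi) X.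
Proof.
move=> phi_inj; split=> [[f [fP f_inj]]|[f [fP f_inj]]].
  exists (f \o phi); split=> [x xX|x y xX yX /= fxy]; first by apply/fP/imset_f.
  by apply/phi_inj/f_inj; rewrite ?imset_f.
pose g i := if [pick x in X | phi x == i] is Some x then f x else None.
have gE x : x \in X -> g (phi x) = f x.
  move=> xX; rewrite /g; case: pickP => [y /andP [_ /eqP /phi_inj -> //]|/(_ x)].
  by rewrite xX eqxx.
exists g; split=> [_ /imsetP [x xX ->]|_ _ /imsetP [x xX ->] /imsetP [y yX ->]].
  by rewrite gE //; apply: fP.
by rewrite !gE // => /f_inj ->.
Qed.

Lemma thread_family_comp (V : eqType) (I J : Type) (P : I -> seq V) (phi : J -> I) :
  thread_family P -> thread_family (P \o phi).
Proof. by move=> [U D S]; split=> *; [apply: U | apply: D | apply: S]. Qed.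

(** The graph and the relabelling are eliminated: the ground set itself indexes the paths. *)
Lemma path_circular_matroidP (E : finType) (indep : {set E} -> Prop) :
  path_circular_matroid indep <->
  exists (V : finType) (P : E -> seq V),
    thread_family P /\ forall X, indep X <-> tindep P X.
Proof.
split=> [[V [adj [I [P [phi [sg [pc [bij indepE]]]]]]]]|[V [P [tP indepE]]]].
  exists V, (P \o phi); split.
    exact: thread_family_comp (path_circular_threads sg pc).
  by move=> X; rewrite indepE tindep_imset //; apply: bij_inj.
have [adj sg pc] := threads_path_circular tP.
exists V, adj, E, P, id; split=> //; split=> //; split; first by exists id.
by move=> X; rewrite imset_id.
Qed.

(** * Shifting matchings along the contracted path *)

(* Going through the positions in increasing order, one hole is kept free; the
   positions selected by [a] fill it and move it to the right end. *)
Lemma hole_shift (n : nat) (a : pred nat) :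
  exists (rho : nat -> nat) (m : nat), [/\ m <= n,
    forall i, i < n -> [/\ rho i <= n, rho i != m &
                           if a i then rho i <= i else i < rho i]
    & forall i j, i < n -> j < n -> rho i = rho j -> i = j].
Proof.
elim: n => [|n [rho [m [mn rhoP rho_inj]]]]; first by exists id, 0.
(* If selected, position [n] fills the hole [m] and the hole becomes [n.+1]; otherwise [n] goes to
   [n.+1] and the hole stays. *)
pose q := if a n then m else n.+1.
exists (fun i => if i == n then q else rho i), (if a n then n.+1 else m).
have qrho i : i < n -> rho i != q.
  move=> /rhoP [le ne _]; rewrite /q; case: ifP => // _.
  by rewrite neq_ltn ltnS le.
split=> [|i|i j].
- by case: ifP => // _; apply: leqW.
- rewrite ltnS leq_eqVlt; case: eqP => [-> _|_ /= lt_in].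
    rewrite /q; case: (a n); rewrite ?leqnn ?mn ?(leqW mn) //; split=> //.
      by rewrite neq_ltn ltnS mn.
    by rewrite neq_ltn ltnS mn orbT.
  have [le ne h] := rhoP _ lt_in; split=> //; first exact: leqW.
  by case: ifP => // _; rewrite neq_ltn ltnS le.
rewrite !ltnS (leq_eqVlt i) (leq_eqVlt j).
case: eqP => [-> _|_ /= lt_in]; case: eqP => [-> _ //|_ /= lt_jn].
- by move=> /esym/eqP; rewrite (negbTE (qrho _ lt_jn)).
- by move=> /eqP; rewrite (negbTE (qrho _ lt_in)).
exact: rho_inj.
Qed.

Lemma infix2_index (T : eqType) (e : seq T) x0 u d :
  uniq e -> infix [:: u; d] e ->
  (index u e).+1 < size e /\ d = nth x0 e (index u e).+1.
Proof.
move=> Ue /infixP [p [q E]]; move: Ue; rewrite E cat_uniq => /and3P [_ h _].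
have up : u \notin p by apply: contra h => up; rewrite /= up.
rewrite index_cat (negbTE up) /= eqxx addn0 size_cat /= !addnS !ltnS leq_addr.
by rewrite nth_cat ltnNge leqnSn /= subSnn.
Qed.

Lemma infix2_nth (T : eqType) (e : seq T) x0 i :
  i.+1 < size e -> infix [:: nth x0 e i; nth x0 e i.+1] e.
Proof.
move=> lt_i; apply/infixP; exists (take i e), (drop i.+2 e).
by rewrite /= -!drop_nth ?cat_take_drop // ltnW.
Qed.

Lemma nth_rcons_neq (T : eqType) (s : seq T) v i :
  uniq (rcons s v) -> i < size s -> nth v (rcons s v) i != v.
Proof.
rewrite rcons_uniq nth_rcons => /andP [vs _] lt_i; rewrite lt_i.
by apply: contra vs => /eqP <-; apply: mem_nth.
Qed.

(* [v] is meant to be the last vertex of [P e0]. *)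
Definition contract_presentation (V E : finType) (e0 : E) (P : E -> seq V)
    (v : V) (Q : {x : E | x != e0} -> seq V) : Prop :=
  forall x u, u \in Q x <->
  u != v /\ (u \in P (val x) \/ exists2 d, infix [:: u; d] (P e0) & d \in P (val x)).

Lemma tindep_contract_sub (V E : finType) (e0 : E) (P : E -> seq V)
    (e' : seq V) (v : V) (Q : {x : E | x != e0} -> seq V) (X : {set {x : E | x != e0}}) :
  P e0 = rcons e' v -> uniq (P e0) -> contract_presentation P v Q ->
  tindep P (e0 |: [set val x | x in X]) -> tindep Q X.
Proof.
rewrite /contract_presentation => Ee; rewrite Ee => Ue memQ [f [fP f_inj]].
set e := rcons e' v in Ee Ue memQ.
have se : size e = (size e').+1 by rewrite size_rcons.
have [um [fe0 ume]] := fP e0 (setU11 _ _); rewrite Ee in ume.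
pose m := index um e; have mn : m <= size e' by rewrite -ltnS -se index_mem.
pose g w := if (w \in e) && (m < index w e) then nth v e (index w e).-1 else w.
have valX x : x \in X -> val x \in e0 |: [set val x | x in X].
  by move=> xX; rewrite inE imset_f ?orbT.
have fX x : x \in X -> exists w, [/\ f (val x) = Some w, w \in P (val x) & w != um].
  move=> xX; have [w [fw wx]] := fP _ (valX _ xX); exists w; split=> //.
  apply/eqP => wum; have : f (val x) = f e0 by rewrite fw fe0 wum.
  by move/f_inj; rewrite valX // setU11 => /(_ isT isT) /eqP; apply/negP/(valP x).
have g_inj w1 w2 : w1 != um -> w2 != um -> g w1 = g w2 -> w1 = w2.
  have pred_lt a : a \in e -> (index a e).-1 < size e.
    by move=> ae; apply: leq_ltn_trans (leq_pred _) _; rewrite index_mem.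
  (* A vertex moved onto [b] lands at position [m] or beyond; as [b] is not [um], [b] is strictly
     beyond [m] and is itself moved. So moved and fixed vertices do not collide. *)
  have half a b : b != um -> a \in e -> m < index a e ->
      nth v e (index a e).-1 = b -> (b \in e) && (m < index b e).
    move=> bum ae ma Eb; rewrite -Eb mem_nth ?pred_lt //=.
    rewrite index_uniq ?pred_lt // ltn_neqAle -ltnS (ltn_predK ma) ma andbT.
    by apply: contra bum => /eqP mE; rewrite -Eb -mE nth_index.
  move=> n1 n2; rewrite /g.
  case: ifP => [/andP [e1 m1]|h1]; case: ifP => [/andP [e2 m2]|h2] // Eg.
  - move/eqP: Eg; rewrite nth_uniq ?pred_lt // => /eqP Ei.
    rewrite -(nth_index v e1) -(nth_index v e2).
    by rewrite -(ltn_predK m1) -(ltn_predK m2) Ei.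
  - by rewrite (half w1) in h2.
  - by rewrite (half w2) in h1.
exists (fun x => omap g (f (val x))); split=> [x xX|x y xX yX].
  have [w [-> wx wum]] := fX _ xX; exists (g w); split=> //; apply/memQ.
  rewrite /g; case: ifP => [/andP [we mw]|].
    have iw : index w e < size e by rewrite index_mem.
    have pw : (index w e).-1.+1 = index w e by apply: ltn_predK mw.
    split; first by apply: nth_rcons_neq => //; rewrite -ltnS -se pw.
    right; exists w => //; have := @infix2_nth _ e v (index w e).-1.
    by rewrite pw nth_index //; apply.
  (* A vertex that stays is not [v]: the last position exceeds [m] unless [v] is [um], which [e0]
     already uses. *)
  move=> h; split; last by left.
  apply: contraFneq h => wv; rewrite wv mem_rcons mem_head /=.
  have iv : index v e = size e'.
    move: Ue; rewrite rcons_uniq /e -cats1 index_cat => /andP [/negbTE -> _] /=.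
    by rewrite eqxx addn0.
  rewrite iv ltn_neqAle mn andbT -iv; apply: contra wum => /eqP E1.
  by rewrite wv -(nth_index v ume) -/m E1 nth_index ?mem_rcons ?mem_head.
have [w1 [fx _ n1]] := fX _ xX; have [w2 [fy _ n2]] := fX _ yX.
rewrite fx fy /= => -[/(g_inj _ _ n1 n2) w12]; apply/val_inj/f_inj; rewrite ?valX //.
by rewrite fx fy w12.
Qed.

Lemma tindep_contract_sup (V E : finType) (e0 : E) (P : E -> seq V)
    (e' : seq V) (v : V) (Q : {x : E | x != e0} -> seq V) (X : {set {x : E | x != e0}}) :
  P e0 = rcons e' v -> uniq (P e0) -> (forall x, end_closed (P e0) (P x)) ->
  contract_presentation P v Q ->
  tindep Q X -> tindep P (e0 |: [set val x | x in X]).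
Proof.
rewrite /contract_presentation => Ee; rewrite Ee => Ue Se memQ [f [fP f_inj]].
set e := rcons e' v in Ee Ue Se memQ.
have se : size e = (size e').+1 by rewrite size_rcons.
(* Positions count from 0, so [take i.+1 e] ends with the vertex at position [i]. The selected
   positions are those whose element may move left. *)
pose a i := [exists x in X, (f x == Some (nth v e i)) &&
                            all (mem (P (val x))) (take i.+1 e)].
have [rho [m [mn rhoP rho_inj]]] := hole_shift (size e') a.
pose g w := if w \in e then nth v e (rho (index w e)) else w.
have fX x : x \in X ->
    exists w, [/\ f x = Some w, w \in Q x & w \in e -> index w e < size e'].
  move=> xX; have [w [fw wx]] := fP _ xX; exists w; split=> // we.
  have [wv _] := (memQ x w).1 wx.
  rewrite ltn_neqAle -ltnS -se index_mem we andbT; apply: contra wv => /eqP Ei.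
  by rewrite -(nth_index v we) Ei nth_rcons ltnn eqxx.
have gP x w : x \in X -> f x = Some w -> g w \in P (val x).
  move=> xX fw; have [w' [fw' wx we]] := fX _ xX.
  move: fw'; rewrite fw => -[Ew]; rewrite -{w'}Ew in wx we.
  rewrite /g; case: ifP => [ew|/negbT ew]; last first.
    case/memQ: wx => _ [//|[d /infix_mem2 [we' _]]]; by rewrite we' in ew.
  have {we} lt_i := we ew; set i := index w e in lt_i *.
  have Ew : nth v e i = w by rewrite nth_index.
  have [rn _] := rhoP _ lt_i; case: ifP => [ai le_ri|ai lt_ri].
    case/existsP: ai => y /and3P [yX /eqP fy]; rewrite Ew -fw in fy.
    rewrite (f_inj _ _ yX xX fy) => /allP; apply.
    by rewrite -(nth_take v (n0 := i.+1)) // mem_nth // size_takel ?se ?ltnS // ltnW.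
  (* Not being selected excludes the initial stretch, so end-closedness at position [i] or [i.+1],
     whichever is in the path, gives everything after [i]. *)
  have subR : {subset drop i.+1 e <= P (val x)}.
    have pre : {subset take i.+1 e <= P (val x)} -> a i.
      by move=> ts; apply/existsP; exists x; rewrite xX Ew fw eqxx /=; apply/allP.
    have split_at j : j < size e -> nth v e j \in P (val x) ->
        {subset take j.+1 e <= P (val x)} \/ {subset drop j e <= P (val x)}.
      move=> lt_j jx; rewrite (take_nth v lt_j) (drop_nth v lt_j).
      by apply: Se jx; rewrite -drop_nth // cat_take_drop.
    have lt_ie : i.+1 < size e by rewrite se ltnS.
    case/memQ: wx => _ [wx|[d wd dx]].
      case: (split_at i (ltnW lt_ie)) => [|h|h]; first by rewrite Ew.
        by rewrite (pre h) in ai.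
      by move=> z zs; apply: h; rewrite (drop_nth v (ltnW lt_ie)) inE zs orbT.
    have [_ Ed] := infix2_index v Ue wd; rewrite Ed in dx.
    case: (split_at _ lt_ie dx) => // h.
    rewrite pre // in ai => z zs; apply: h.
    by rewrite (take_nth v lt_ie) mem_rcons inE zs orbT.
  apply: subR; rewrite -(subnKC lt_ri) -nth_drop mem_nth // size_drop se.
  by rewrite ltn_sub2r // ltnS.
have ge w : w \in e -> index w e < size e' -> g w != nth v e m /\ g w \in e.
  move=> we /rhoP [rn rm _]; rewrite /g we mem_nth ?se //.
  by rewrite nth_uniq ?se.
have g_inj w1 w2 : (w1 \in e -> index w1 e < size e') ->
    (w2 \in e -> index w2 e < size e') -> g w1 = g w2 -> w1 = w2.
  move=> l1 l2; rewrite /g; case: ifP => [e1|e1]; case: ifP => [e2|e2] //.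
  - have [r1 _ _] := rhoP _ (l1 e1); have [r2 _ _] := rhoP _ (l2 e2).
    move=> /eqP; rewrite nth_uniq ?se // => /eqP /rho_inj Ei.
    by rewrite -(nth_index v e1) -(nth_index v e2) Ei ?l1 ?l2.
  - have [_] := ge _ e1 (l1 e1); rewrite /g e1 => h Eg; by rewrite -Eg h in e2.
  - have [_] := ge _ e2 (l2 e2); rewrite /g e2 => h Eg; by rewrite Eg h in e1.
(* The hole left free by [rho] is given to [e0]. *)
pose h y := if y == e0 then Some (nth v e m) else
  if insub y is Some x then omap g (f x) else None.
have hv x : h (val x) = omap g (f x).
  by rewrite /h (negbTE (valP x)) valK.
have me : nth v e m \in e by rewrite mem_nth // se.
have h0 x : x \in X -> h (val x) <> h e0.
  move=> xX; have [w [fw _ wlt]] := fX _ xX; rewrite hv fw /h eqxx /= => -[].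
  case: (boolP (w \in e)) => we; first by apply/eqP; case: (ge w we (wlt we)).
  by rewrite /g (negbTE we) => wE; rewrite wE me in we.
exists h; split=> [y|y1 y2].
  rewrite !inE => /predU1P [->|/imsetP [x xX ->]].
    by exists (nth v e m); rewrite /h eqxx Ee.
  have [w [fw wx _]] := fX _ xX.
  by exists (g w); rewrite hv fw; split=> //; apply: gP.
rewrite !inE => /predU1P [->|/imsetP [x1 x1X ->]] /predU1P [->|/imsetP [x2 x2X ->]] //.
- by move/esym/(h0 _ x2X).
- by move/(h0 _ x1X).
have [w1 [fw1 _ l1]] := fX _ x1X; have [w2 [fw2 _ l2]] := fX _ x2X.
rewrite !hv fw1 fw2 => -[/(g_inj _ _ l1 l2) w12].
by congr val; apply: f_inj; rewrite // fw1 fw2 w12.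
Qed.

(** * Minors of path-circular matroids *)

Theorem theorem1p3 (E : finType) (indep : {set E} -> Prop) (e : E) :
  path_circular_matroid indep ->
  path_circular_matroid (del_indep indep e) /\
  path_circular_matroid (con_indep indep e).
Proof.
move=> /path_circular_matroidP [V [P [tP indepE]]].
have del : path_circular_matroid (del_indep indep e).
  apply/path_circular_matroidP; exists V, (P \o val); split.
    exact: thread_family_comp.
  by move=> X; rewrite /del_indep indepE tindep_imset //; apply: val_inj.
(* If [P e] is the null path, [e] is a loop and contracting it amounts to deleting it. *)
split=> //; case/lastP Ee: (P e) => [|e' v].
  have ne : ~ indep [set e].
    rewrite indepE => -[f [fP _]]; have [u []] := fP e (set11 e).
    by rewrite Ee.
  have [W [Q [tQ delE]]] := (path_circular_matroidP _).1 del.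
  apply/path_circular_matroidP; exists W, Q; split=> // X.
  by rewrite -delE /con_indep /del_indep; split=> [[_ /(_ ne)] | ].
have ie : indep [set e].
  rewrite indepE; exists (fun=> Some v); split=> [x|x y]; last first.
    by rewrite !inE => /eqP -> /eqP ->.
  by rewrite inE => /eqP ->; exists v; rewrite Ee mem_rcons mem_head.
have [U D S] := tP.
have [Q extQ] := fin_all_exists (fun x => extends_exists (S e x) (D x e)).
pose R x := filter (predC1 v) (Q x).
have tR : thread_family R by apply: thread_family_contract tP Ee extQ.
have memR : contract_presentation P v (fun x : {x : E | x != e} => R (val x)).
  move=> x u; rewrite mem_filter /= -(rwP andP).
  by rewrite (mem_extends _ (U e) (S e _) (extQ _)).
apply/path_circular_matroidP; exists V, (R \o val); split.
  exact: thread_family_comp.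
move=> X; have -> : con_indep indep e X <-> indep (e |: [set val x | x in X]).
  by rewrite /con_indep; split=> [[/(_ ie)]|].
rewrite indepE; split.
  exact: tindep_contract_sub Ee (U e) memR.
exact: tindep_contract_sup Ee (U e) (S e) memR.
Qed.
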